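(* Fix $p\in(0,1)$ and put $q=1-p$. Let $T_{n,p}$ be the post-loss completion time of the careless coupon collector on $n$ types started from the empty collection, let $\nu_n$ be the stationary law of the count chain $K_t=|S_t|$, and let $\mu_n:=\mathbb P_{\nu_n}(K_0<n,K_1=n)$. Then $\mu_nT_{n,p}\Rightarrow\mathrm{Exp}(1)$, and moreover $\mu_n\sim\frac{1}{(q;q)_\infty}\frac{n!}{n^n}q^{n(n+1)/2}$ as $n\to\infty$.
   Context: Careless coupon collector (post-loss convention): $S_t\subseteq[n]$ is the set of held coupons after round $t$, $S_0=\emptyset$. In round $t$, a type $J_t$ is drawn uniformly from $[n]$ independently of the past, and then each coupon of $S_t\cup\{J_t\}$ is independently lost with probability $p$; $S_{t+1}$ is the set of survivors. $K_t=|S_t|$ is then an irreducible aperiodic Markov chain on $\{0,\dots,n\}$ with unique stationary law $\nu_n$. $T_{n,p}=\inf\{t\ge0:S_t=[n]\}$. $(q;q)_\infty:=\prod_{r=1}^\infty(1-q^r)$. $\mathrm{Exp}(1)$ is the exponential law with mean 1. *)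

(* Defs.v *)
From HB Require Import structures.
From mathcomp Require Import all_boot all_order all_algebra.
From mathcomp Require Import all_classical all_reals all_analysis.
Set Implicit Arguments. Unset Strict Implicit. Unset Printing Implicit Defensive.
Import Order.TTheory GRing.Theory Num.Theory.
Import numFieldTopology.Exports numFieldNormedType.Exports.
Local Open Scope ring_scope.

Section CarelessCoupon.
Variable R : realType.

(* One-step transition kernel of the set chain S_t on subsets of [n] = 'I_n
   (post-loss convention): draw J uniform in 'I_n, then every coupon of
   S :|: [set J] survives independently with probability q = 1 - p. *)
Definition setP (n : nat) (p : R) (S S' : {set 'I_n}) : R :=
  n%:R^-1 * \sum_(j : 'I_n)
    (if S' \subset (j |: S)
     then (1 - p) ^+ #|S'| * p ^+ (#|j |: S| - #|S'|)
     else 0).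

Definition repset (n k : nat) : {set 'I_n} := [set i : 'I_n | (val i < k)%N].

Definition countP (n : nat) (p : R) (k l : nat) : R :=
  \sum_(S' : {set 'I_n} | #|S'| == l) setP p (repset n k) S'.

Definition count_stationary (n : nat) (p : R) (nu : nat -> R) : Prop :=
  [/\ forall k, (k <= n)%N -> 0 <= nu k,
      \sum_(k < n.+1) nu k = 1
    & forall l, (l <= n)%N -> \sum_(k < n.+1) nu k * countP n p k l = nu l].

Definition mu_of (n : nat) (p : R) (nu : nat -> R) : R :=
  \sum_(k < n) nu k * countP n p k n.

(* Sub-probability distribution of S_t on the event {S_0, ..., S_t all <> [n]},
   started from S_0 = set0. *)
Fixpoint killed (n : nat) (p : R) (t : nat) : {set 'I_n} -> R :=
  match t with
  | 0 => fun S => if (S == finset.set0) && (S != [set: 'I_n]) then 1 else 0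
  | t'.+1 => fun S' => if S' != [set: 'I_n]
             then \sum_(S : {set 'I_n}) killed p t' S * setP p S S'
             else 0
  end.

(* P(T_{n,p} = t), T = inf {t >= 0 : S_t = [n]}, S_0 = set0. *)
Definition probT (n : nat) (p : R) (t : nat) : R :=
  match t with
  | 0 => if (finset.set0 : {set 'I_n}) == [set: 'I_n] then 1 else 0
  | t'.+1 => \sum_(S : {set 'I_n}) killed p t' S * setP p S [set: 'I_n]
  end.

Definition cdf_scaledT (n : nat) (p c x : R) : R :=
  limn (series (fun t : nat => if c * t%:R <= x then probT n p t else 0)).

Definition exp1_cdf (x : R) : R := if x < 0 then 0 else 1 - expR (- x).

Definition qpoch_inf (q : R) : R :=
  limn (fun N : nat => \prod_(r < N) (1 - q ^+ r.+1)).

End CarelessCoupon.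

(* Main.v *)
(* A stationary law nu is computed from its binomial moments: if M_r is the
   nu-mean of 'C(K, r), then
     M_r (1 - q^r (1 - r/n)) = q^r (n-r+1)/n M_(r-1),
   and M_n = nu(n) gives a product formula for mu = nu(n) (1 - q^n), whence the
   asymptotics.

   For the limit law let h_t(S) be the probability of not being full during
   rounds 0..t when starting from S, and a_t its nu-mean.  Stationarity gives
   a_t - a_(t+1) = nu(n) E[h_t(S_1) | S_0 full].  Coupling shows that h_t(S) is
   within 2 n q^n of h_t(empty) for all S that are not full, so this difference
   is mu a_t up to an error mu O(n q^n), uniformly in t.  Therefore
   h_t(empty) = (1 - mu)^t + O(n q^n) uniformly in t. *)

Require Import Defs.
From HB Require Import structures.
From mathcomp Require Import all_boot all_order all_algebra.
From mathcomp Require Import all_classical all_reals all_analysis.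
From mathcomp Require Import ring lra.
Import Order.TTheory GRing.Theory Num.Theory.
Import numFieldTopology.Exports numFieldNormedType.Exports.
Local Open Scope ring_scope.

Section CouponChain.
Set Implicit Arguments.
Unset Strict Implicit.
Variables (R : realType) (n : nat) (p : R).
Implicit Types (S T A B X : {set 'I_n}) (f : {set 'I_n} -> R) (g : nat -> R).
Local Notation q := (1 - p).
Local Notation full := [set: 'I_n].

(** * The transition operator and independent losses *)

Definition step f S : R := \sum_(S' : {set 'I_n}) Defs.setP p S S' * f S'.

Definition thin f T : R :=
  \sum_(S : {set 'I_n} | S \subset T) q ^+ #|S| * p ^+ (#|T| - #|S|) * f S.

(** Probability that [X] is exactly the set of types spared in a round, when all [n] types receive
    loss marks, held or not. *)
Definition weight X : R := \prod_(i < n) (if i \in X then q else p).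

Lemma step_thin f S : step f S = n%:R^-1 * \sum_(j < n) thin f (j |: S).
Proof.
rewrite /step /thin /Defs.setP mulr_sumr.
under [RHS]eq_bigr do rewrite big_mkcond mulr_sumr.
rewrite exchange_big; apply: eq_bigr => S' _ /=.
rewrite -mulrA mulr_suml mulr_sumr; apply: eq_bigr => j _.
by case: ifP => _; rewrite ?mul0r.
Qed.

(** The marks outside [T] are free and contribute factors q + p = 1; those inside [T] are forced by
    [S]. *)
Lemma sum_weight_fiber T S :
  S \subset T ->
  \sum_(X : {set 'I_n} | T :&: X == S) weight X = q ^+ #|S| * p ^+ (#|T| - #|S|).
Proof.
move=> sST.
(* [E i] and [F i] are the factors for [i] inside and outside [X], set to 0 when that choice
   contradicts [T :&: X = S]; distributivity then produces the sum over [X]. *)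
pose E (i : 'I_n) : R := if i \in T then (if i \in S then q else 0) else q.
pose F (i : 'I_n) : R := if i \in T then (if i \in S then 0 else p) else p.
transitivity (\prod_(i < n) (E i + F i)); last first.
  transitivity (\prod_(i in S) q * \prod_(i in T :\: S) p).
    rewrite (bigID (mem S)) /=; congr (_ * _).
      apply: eq_bigr => i iS.
      by rewrite /E /F (fintype.subsetP sST _ iS) iS addr0.
    rewrite (bigID (mem T)) /= [X in _ * X]big1 ?mulr1; last first.
      move=> i /andP[iS iT]; rewrite /E /F (negbTE iT); ring.
    apply: eq_big => [i|i /andP[iS iT]]; first by rewrite !inE.
    by rewrite /E /F (negbTE iS) iT add0r.
  by rewrite !prodr_const cardsDS.
rewrite bigA_distr [RHS](bigID (fun X : {set 'I_n} => T :&: X == S)) /=.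
rewrite [X in _ + X]big1 ?addr0; last first.
  move=> X; apply: contraNeq => /prodf_neq0 nz.
  apply/eqP/setP => i; rewrite !inE; have := nz i isT; rewrite /E /F.
  case: (boolP (i \in T)) => iT; last first.
    by rewrite (contraNF (fintype.subsetP sST i) iT).
  by do 2 case: ifP; rewrite ?eqxx.
apply: eq_bigr => X /eqP eS; apply: eq_bigr => i _; rewrite /E /F -eS !inE.
by case: (i \in T); case: (i \in X).
Qed.

(** A single random [X] serves every [T], so two collections can be thinned with the same losses;
    the coupling below rests on this. *)
Lemma thin_weight f T : thin f T = \sum_(X : {set 'I_n}) weight X * f (T :&: X).
Proof.
rewrite (partition_big (fun X => T :&: X) (fun S => S \subset T)) /=; last first.
  by move=> X _; exact: subsetIl.
apply: eq_bigr => S sST; rewrite -(sum_weight_fiber sST) mulr_suml.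
by apply: eq_bigr => X /eqP ->.
Qed.

Lemma sum_weight : \sum_(X : {set 'I_n}) weight X = 1.
Proof.
rewrite -(bigA_distr _ _ (fun _ : 'I_n => q) (fun => p)) /=.
by rewrite big1 // => i _; rewrite subrK.
Qed.

Lemma thin_cst c T : thin (fun => c) T = c.
Proof. by rewrite thin_weight -mulr_suml sum_weight mul1r. Qed.

Lemma card_set_le S : (#|S| <= n)%N.
Proof. by have := max_card S; rewrite card_ord. Qed.

Lemma thin_card g T :
  thin (fun S => g #|S|) T =
  \sum_(l < n.+1) 'C(#|T|, l)%:R * (q ^+ l * p ^+ (#|T| - l) * g l).
Proof.
have card_le S : (#|S| < n.+1)%N by rewrite ltnS card_set_le.
rewrite /thin (partition_big (fun S => Ordinal (card_le S)) xpredT) //=.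
apply: eq_bigr => l _.
rewrite (eq_bigr (fun=> q ^+ l * p ^+ (#|T| - l) * g l)); last first.
  by move=> S /andP[_ /eqP <-].
rewrite sumr_const -cards_draws mulr_natl; congr (_ *+ _).
by apply: eq_card => S; rewrite !inE.
Qed.

(** * From sets to counts *)

Lemma card_repset k : (k <= n)%N -> #|repset n k| = k.
Proof.
move=> kn; rewrite -sum1_card.
rewrite (eq_bigl (fun i : 'I_n => (i < k)%N)); last by move=> i; rewrite inE.
by rewrite (big_ord_narrow kn) sum1_card card_ord.
Qed.

Lemma repset_full : repset n n = full.
Proof. by apply/setP => i; rewrite !inE ltn_ord. Qed.

Definition card_inv f := forall S T, #|S| = #|T| -> f S = f T.

Lemma card_invE f : card_inv f -> f = (fun S => f (repset n #|S|)).
Proof. by move=> fi; apply/funext => S; apply: fi; rewrite card_repset ?card_set_le. Qed.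

Lemma sum_setU1 g S :
  \sum_(j < n) g #|j |: S| = #|S|%:R * g #|S| + (n%:R - #|S|%:R) * g #|S|.+1.
Proof.
rewrite (bigID (mem S)) /=; congr (_ + _).
  rewrite (eq_bigr (fun=> g #|S|)); last first.
    by move=> i iS; rewrite cardsU1 iS.
  by rewrite sumr_const mulr_natl.
rewrite (eq_bigr (fun=> g #|S|.+1)); last first.
  by move=> i iS; rewrite cardsU1 iS.
rewrite sumr_const -natrB ?card_set_le // mulr_natl; congr (_ *+ _).
have := cardsCs S; rewrite card_ord => ->.
rewrite subKn; last by rewrite card_set_le.
by apply: eq_card => i; rewrite inE.
Qed.

(** Lumpability: after a draw and the losses, the law of the size depends on the old size only. *)
Lemma step_card_inv f : card_inv f -> card_inv (step f).
Proof.
move=> /card_invE -> S T eST; rewrite !step_thin; congr (_ * _).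
under eq_bigr do rewrite (thin_card (fun k => f (repset n k))).
under [RHS]eq_bigr do rewrite (thin_card (fun k => f (repset n k))).
by rewrite !(sum_setU1 (fun k => \sum_(l < n.+1) 'C(k, l)%:R *
   (q ^+ l * p ^+ (k - l) * f (repset n l)))) eST.
Qed.

Lemma step_repset f k :
  card_inv f -> (k <= n)%N ->
  step f (repset n k) = \sum_(l < n.+1) countP n p k l * f (repset n l).
Proof.
move=> fi kn.
have card_lt S : (#|S| < n.+1)%N by rewrite ltnS card_set_le.
rewrite /step (partition_big (fun S => Ordinal (card_lt S)) xpredT) //=.
apply: eq_bigr => l _; rewrite /countP mulr_suml.
apply: eq_big => [S|S /eqP <- /=]; first by rewrite -val_eqE.
by congr (_ * _); apply: fi; rewrite card_repset ?card_set_le.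
Qed.

(** Since [nu] lives on counts, its invariance passes to the set chain only through functions of the
    cardinality. *)
Lemma stationary_step (nu : nat -> R) f :
  count_stationary n p nu -> card_inv f ->
  \sum_(k < n.+1) nu k * step f (repset n k)
    = \sum_(k < n.+1) nu k * f (repset n k).
Proof.
case=> _ _ st fi.
transitivity (\sum_(k < n.+1) \sum_(l < n.+1)
    nu k * countP n p k l * f (repset n l)).
  apply: eq_bigr => k _; rewrite (step_repset fi (leq_ord k)) mulr_sumr.
  by apply: eq_bigr => l _; rewrite mulrA.
rewrite exchange_big /=; apply: eq_bigr => l _.
by rewrite -mulr_suml (st l (leq_ord l)).
Qed.


(** * Binomial moments *)

(** The binomial counts the [r]-subsets, and each [r]-subset of [T] survives whole with probability
    [q ^+ r]. *)
Lemma thin_bin r T :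
  thin (fun S => 'C(#|S|, r)%:R) T = q ^+ r * 'C(#|T|, r)%:R.
Proof.
have binE S : 'C(#|S|, r)%:R =
    \sum_(A : {set 'I_n} | #|A| == r) (A \subset S)%:R :> R.
  rewrite -cards_draws -sum1_card natr_sum big_mkcond [RHS]big_mkcond.
  by apply: eq_bigr => A _; rewrite inE; case: (_ \subset _); case: (_ == r).
rewrite thin_weight binE mulr_sumr.
under eq_bigr do rewrite binE mulr_sumr.
rewrite exchange_big; apply: eq_bigr => A /eqP cA.
have [sAT|nsAT] := boolP (A \subset T); last first.
  by rewrite mulr0 big1 // => X _; rewrite finset.subsetI (negbTE nsAT) mulr0.
have := sum_weight_fiber (fintype.subxx A).
rewrite subnn expr0 cA !mulr1 => <-; rewrite [RHS]big_mkcond.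
apply: eq_bigr => X _; rewrite finset.subsetI sAT /= (sameP finset.setIidPl eqP).
by case: eqP; rewrite (mulr1, mulr0).
Qed.

Hypothesis n_gt0 : (0 < n)%N.

Let n_neq0 : n%:R != 0 :> R.
Proof. by rewrite pnatr_eq0 -lt0n. Qed.

(** Pascal's rule handles a new coupon. The moment equations close because the extra factor [#|S|]
    is absorbed by (k - r) C(k, r) = (r + 1) C(k, r + 1). *)
Lemma step_bin r S :
  step (fun S => 'C(#|S|, r.+1)%:R) S =
  q ^+ r.+1 * ((1 - r.+1%:R / n%:R) * 'C(#|S|, r.+1)%:R
               + (n%:R - r%:R) / n%:R * 'C(#|S|, r)%:R).
Proof.
rewrite step_thin; under eq_bigr do rewrite thin_bin.
rewrite -mulr_sumr (sum_setU1 (fun k => 'C(k, r.+1)%:R)) binS natrD.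
have : (#|S|%:R - r%:R) * 'C(#|S|, r)%:R = r.+1%:R * 'C(#|S|, r.+1)%:R :> R.
  rewrite -[RHS]natrM mul_bin_left.
  have [rS|Sr] := leqP r #|S|; first by rewrite natrM natrB.
  by rewrite bin_small // muln0 mulr0.
set k := #|S|%:R; set x := 'C(_, r)%:R; set y := 'C(_, r.+1)%:R => h.
have -> : k * y + (n%:R - k) * (y + x)
    = n%:R * y + (n%:R - r%:R) * x - r.+1%:R * y by rewrite -h; ring.
by field.
Qed.

Lemma step_cst c S : step (fun=> c) S = c.
Proof.
rewrite step_thin; under eq_bigr do rewrite thin_cst.
by rewrite sumr_const card_ord -(mulr_natl c n) mulrA mulVf ?mul1r.
Qed.

Lemma sum_setP S : \sum_(S' : {set 'I_n}) Defs.setP p S S' = 1.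
Proof. by rewrite -[RHS](step_cst 1 S); apply: eq_bigr => ? _; rewrite mulr1. Qed.

Lemma step_full S :
  step (fun S => (S == full)%:R) S = Defs.setP p S full.
Proof.
rewrite /step (bigD1 full) //= eqxx mulr1 big1 ?addr0 // => X /negbTE ->.
by rewrite mulr0.
Qed.

Hypothesis p01 : 0 < p < 1.

Let q_ge0 : 0 <= q. Proof. by case/andP: p01 => *; lra. Qed.
Let q_lt1 : q < 1. Proof. by case/andP: p01 => *; lra. Qed.
Let p_ge0 : 0 <= p. Proof. by case/andP: p01 => *; lra. Qed.
Let qn_ge0 m : 0 <= q ^+ m. Proof. exact: exprn_ge0. Qed.

(** * Positivity and the probability of a full collection *)

Lemma setP_ge0 S S' : 0 <= Defs.setP p S S'.
Proof.
rewrite /Defs.setP mulr_ge0 ?invr_ge0 ?ler0n // sumr_ge0 // => j _.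
by case: ifP => // _; rewrite mulr_ge0 ?exprn_ge0.
Qed.

Lemma weight_ge0 X : 0 <= weight X.
Proof. by rewrite prodr_ge0 // => i _; case: ifP. Qed.

Lemma le_step f1 f2 S : (forall S', f1 S' <= f2 S') -> step f1 S <= step f2 S.
Proof. by move=> h; apply: ler_sum => S' _; rewrite ler_wpM2l ?setP_ge0. Qed.

Lemma setP_full_le S : Defs.setP p S full <= q ^+ n.
Proof.
rewrite /Defs.setP ler_pdivrMl ?ltr0n // mulr_natl.
apply: (@le_trans _ _ (\sum_(j < n) q ^+ n)); last by rewrite sumr_const card_ord.
apply: ler_sum => j _; rewrite cardsT card_ord; case: ifP => // _.
by have /eqP -> : (#|j |: S| - n == 0)%N := card_set_le _; rewrite expr0 mulr1.
Qed.

Lemma setP_full : Defs.setP p full full = q ^+ n.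
Proof.
rewrite /Defs.setP (eq_bigr (fun=> q ^+ n)); last first.
  by move=> j _; rewrite finset.setUT fintype.subxx subnn cardsT card_ord mulr1.
by rewrite sumr_const card_ord -[q ^+ n *+ n]mulr_natl mulrA mulVf ?mul1r.
Qed.

Lemma card_full S : (#|S| == n) = (S == full).
Proof. by rewrite eqEcard finset.subsetT cardsT card_ord eqn_leq card_set_le. Qed.

Lemma countP_full k : countP n p k n = Defs.setP p (repset n k) full.
Proof. by rewrite /countP (eq_bigl _ _ card_full) big_pred1_eq. Qed.

Lemma repset_neq_full k : (k < n)%N -> repset n k != full.
Proof. by move=> kn; rewrite -card_full card_repset ?ltn_eqF // ltnW. Qed.

(** * Survival probabilities and their dependence on the start *)

(** The function h_t(S), built by conditioning on the first round, whereas [killed] conditions on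
    the last. *)
Fixpoint survive (t : nat) S : R :=
  match t with
  | 0 => (S != full)%:R
  | t'.+1 => if S != full then step (survive t') S else 0
  end.

Lemma survive_full t : survive t full = 0.
Proof. by case: t => [|t] /=; rewrite eqxx. Qed.

Lemma survive_ge0 t S : 0 <= survive t S.
Proof.
elim: t S => [|t IH] S /=; first by rewrite ler0n.
case: ifP => // _; rewrite -[leLHS](step_cst 0 S); exact: le_step.
Qed.

Lemma survive_le1 t S : survive t S <= 1.
Proof.
elim: t S => [|t IH] S /=; first by case: (_ != _).
case: ifP => // _; rewrite -[leRHS](step_cst 1 S); exact: le_step.
Qed.

Lemma survive_card_inv t : card_inv (survive t).
Proof.
elim: t => [|t IH] S T eST /=; rewrite -!card_full eST //.
by rewrite (step_card_inv IH eST).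
Qed.

Lemma survive_dist_le1 t S T : `|survive t S - survive t T| <= 1.
Proof.
have := (survive_ge0 t S, survive_le1 t S, survive_ge0 t T, survive_le1 t T).
by move=> [[[? ?] ?] ?]; rewrite ler_norml; apply/andP; split; lra.
Qed.

(* Run both chains with the same draws and the same losses: the larger one has
   probability at most q^n of becoming full in any given round, and each coupon
   of B minus A remains a discrepancy with probability at most q per round. *)
Lemma survive_coupling m t A B :
  A \subset B -> B != full ->
  `|survive t A - survive t B| <= m%:R * q ^+ n + q ^+ m * #|B :\: A|%:R.
Proof.
elim: m t A B => [|m IH] t A B sAB Bnf.
  rewrite mul0r add0r mul1r.
  have [BA0|] := eqVneq (B :\: A) finset.set0.
    suff -> : A = B by rewrite subrr normr0 ler0n.
    by apply/eqP; rewrite finset.eqEsubset sAB -finset.setD_eq0 BA0 eqxx.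
  rewrite -card_gt0 => c; apply: le_trans (survive_dist_le1 _ _ _) _.
  by rewrite ler1n.
have Anf : A != full.
  by apply: contraNneq Bnf => Af; rewrite -finset.subTset -Af.
case: t => [|t] /=.
  by rewrite Anf Bnf subrr normr0 addr_ge0 // mulr_ge0 ?ler0n.
rewrite Anf Bnf !step_thin -mulrBr -sumrB normrM ger0_norm ?invr_ge0 ?ler0n //.
pose D := B :\: A.
(* The indicator pays for rounds in which the larger chain becomes full; the rest is the induction
   bound averaged over the losses, [q * #|D|%:R] being the mean number of surviving
   discrepancies. *)
pose rhs := n%:R^-1 * \sum_(j < n) (thin (fun S => (S == full)%:R) (j |: B)
   + (m%:R * q ^+ n + q ^+ m * (q * #|D|%:R))).
apply: (@le_trans _ _ rhs); last first.
  rewrite /rhs big_split /= mulrDr -step_thin step_full.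
  rewrite sumr_const card_ord -[(_ + _) *+ n]mulr_natl (mulrA n%:R^-1) mulVf // mul1r.
  by have := setP_full_le B; rewrite -natr1 exprSr; lra.
rewrite ler_wpM2l ?invr_ge0 ?ler0n //; apply: le_trans (ler_norm_sum _ _ _) _.
apply: ler_sum => j _; rewrite !thin_weight -sumrB.
have -> : q * #|D|%:R = \sum_(X : {set 'I_n}) weight X * #|D :&: X|%:R.
  rewrite -(thin_weight (fun S => #|S|%:R)).
  have := thin_bin 1 D; rewrite bin1 => <-.
  by congr (thin _ D); apply/funext => S; rewrite bin1.
have -> : m%:R * q ^+ n = \sum_(X : {set 'I_n}) weight X * (m%:R * q ^+ n).
  by rewrite -mulr_suml sum_weight mul1r.
rewrite mulr_sumr -!big_split /=; apply: le_trans (ler_norm_sum _ _ _) _.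
apply: ler_sum => X _; rewrite -mulrBr normrM ger0_norm ?weight_ge0 //.
rewrite (mulrCA (q ^+ m)) -!mulrDr ler_wpM2l ?weight_ge0 //.
set A' := (j |: A) :&: X; set B' := (j |: B) :&: X.
have [B'f|B'nf] := eqVneq B' full.
  apply: le_trans (survive_dist_le1 _ _ _) _.
  by rewrite lerDl addr_ge0 // mulr_ge0 ?ler0n.
rewrite add0r; apply: le_trans (IH t A' B' _ B'nf) _.
  by rewrite finset.setSI // finset.setUS.
rewrite lerD2l ler_wpM2l // ler_nat subset_leq_card //.
(* A draw common to both chains creates no discrepancy, so those left lie in [D :&: X]. *)
apply/fintype.subsetP => i; rewrite !inE.
by case: (i == j); case: (i \in A); case: (i \in B); case: (i \in X).
Qed.

(** Taking [m = n] balances the two terms of the coupling bound and makes it uniform in [t]. *)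
Lemma survive_set0 t S : S != full ->
  `|survive t S - survive t finset.set0| <= n%:R * q ^+ n *+ 2.
Proof.
move=> Snf; rewrite distrC.
apply: le_trans (survive_coupling n t (finset.sub0set S) Snf) _.
rewrite mulr2n lerD2l mulrC ler_wpM2r // finset.setD0 ler_nat.
exact: card_set_le.
Qed.

(** * The law of the completion time *)

Lemma killed_full t : killed p t full = 0.
Proof. by case: t => [|t] /=; rewrite eqxx ?andbF. Qed.

(** Markov property at time [t]; mass removed at the full set costs nothing because [survive]
    vanishes there. *)
Lemma killed_survive t s :
  \sum_(S : {set 'I_n}) killed p t S * survive s S
    = survive (s + t) finset.set0.
Proof.
elim: t s => [|t IH] s.
  rewrite addn0 (bigD1 finset.set0) //= eqxx /= big1 ?addr0; last first.
    by move=> S /negbTE ->; rewrite mul0r.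
  by case: eqP => [->|_] /=; rewrite ?survive_full (mul0r, mul1r).
rewrite addnS -addSn -IH.
transitivity (\sum_(S' : {set 'I_n}) \sum_(S : {set 'I_n})
   killed p t S * Defs.setP p S S' * survive s S').
  apply: eq_bigr => S' _ /=; rewrite -mulr_suml; case: eqP => // ->.
  by rewrite survive_full !mulr0.
rewrite exchange_big; apply: eq_bigr => S _ /=.
have [->|Snf] := eqVneq S full.
  by rewrite killed_full mul0r big1 // => S' _; rewrite !mul0r.
by rewrite /step mulr_sumr; apply: eq_bigr => S' _; rewrite mulrA.
Qed.

Lemma sum_killed t : \sum_(S : {set 'I_n}) killed p t S = survive t finset.set0.
Proof.
rewrite -[t in RHS]add0n -killed_survive; apply: eq_bigr => S _ /=.
by case: eqP => [->|_]; rewrite ?killed_full (mulr1, mulr0).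
Qed.

(** Rows of the kernel sum to 1, so the killed mass lost in a round is exactly the mass reaching the
    full set. *)
Lemma probTS t :
  probT n p t.+1 = survive t finset.set0 - survive t.+1 finset.set0.
Proof.
rewrite -(sum_killed t) -(sum_killed t.+1) /=.
transitivity (\sum_(S' : {set 'I_n}) \sum_(S : {set 'I_n})
    killed p t S * Defs.setP p S S' -
    \sum_(S' : {set 'I_n} | S' != full) \sum_(S : {set 'I_n})
      killed p t S * Defs.setP p S S').
  by rewrite [X in X - _](bigD1 full) //= addrK.
congr (_ - _); last by rewrite big_mkcond.
rewrite exchange_big; apply: eq_bigr => S _ /=.
by rewrite -mulr_sumr sum_setP mulr1.
Qed.

Lemma sum_probT N : \sum_(t < N.+1) probT n p t = 1 - survive N finset.set0.
Proof.
elim: N => [|N IH].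
  by rewrite big_ord_recl big_ord0 addr0 /=; case: eqP; rewrite (subr0, subrr).
transitivity (1 - survive N finset.set0 + probT n p N.+1).
  by rewrite big_ord_recr IH.
by rewrite probTS addrA subrK.
Qed.

(** * Stationarity and the exponential approximation *)

Section Stationary.
Variable nu : nat -> R.
Hypothesis nuS : count_stationary n p nu.

Let nu_ge0 k : (k <= n)%N -> 0 <= nu k. Proof. by case: nuS => h _ _; exact: h. Qed.
Let nu_sum1 : \sum_(k < n.+1) nu k = 1. Proof. by case: nuS. Qed.

(** Stationarity at level [n] splits [nu n] into arrivals from below, which make up [mu_of], and the
    mass [nu n * q ^+ n] that stays full. *)
Lemma mu_ofE : mu_of n p nu = nu n * (1 - q ^+ n).
Proof.
case: nuS => _ _ /(_ n (leqnn n)); rewrite big_ord_recr /= countP_full.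
rewrite repset_full setP_full => h.
by rewrite /mu_of mulrBr mulr1 -[X in _ = X - _]h addrK.
Qed.

Lemma nu_full_le : nu n <= q ^+ n.
Proof.
case: nuS => _ _ /(_ n (leqnn n)) <-.
rewrite -[leRHS]mul1r -[X in X * _]nu_sum1 mulr_suml; apply: ler_sum => k _.
by rewrite ler_wpM2l ?nu_ge0 ?leq_ord // countP_full setP_full_le.
Qed.

(** The moment recursion telescoped, with the denominators kept on the left. The exponent is 1 + ...
    + m, and the factors n - r build the falling factorial. *)
Lemma stationary_moment m : (m <= n)%N ->
  (\sum_(k < n.+1) nu k * 'C(k, m)%:R) *
    \prod_(r < m) (1 - q ^+ r.+1 * (1 - r.+1%:R / n%:R))
  = q ^+ 'C(m.+1, 2) * ((n ^_ m)%:R / n%:R ^+ m).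
Proof.
elim: m => [|m IH] mn.
  rewrite big_ord0 ffactn0 bin_small // !expr0 invr1 !mulr1 -[RHS]nu_sum1.
  by apply: eq_bigr => k _; rewrite bin0 mulr1.
have cardS k : (k < n.+1)%N -> #|repset n k| = k by move=> *; exact: card_repset.
pose M r := \sum_(k < n.+1) nu k * 'C(k, r)%:R.
(* Invariance applied to [step_bin]; the unknown [M m.+1] stands on both sides and is isolated
   below. *)
have st : M m.+1 = q ^+ m.+1 * ((1 - m.+1%:R / n%:R) * M m.+1
               + (n%:R - m%:R) / n%:R * M m).
  have := @stationary_step nu (fun S => 'C(#|S|, m.+1)%:R) nuS.
  rewrite (eq_bigr (fun k : 'I_n.+1 => q ^+ m.+1 * ((1 - m.+1%:R / n%:R) *
      (nu k * 'C(k, m.+1)%:R) + (n%:R - m%:R) / n%:R * (nu k * 'C(k, m)%:R)))).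
    rewrite -mulr_sumr big_split -!mulr_sumr /= => ->; last by move=> ? ? ->.
    by apply: eq_bigr => k _; rewrite cardS.
  by move=> k _; rewrite step_bin cardS //; ring.
transitivity ((M m.+1 - q ^+ m.+1 * (1 - m.+1%:R / n%:R) * M m.+1) *
   \prod_(i < m) (1 - q ^+ i.+1 * (1 - i.+1%:R / n%:R))).
  by rewrite -/(M m.+1) big_ord_recr /=; ring.
have -> : M m.+1 - q ^+ m.+1 * (1 - m.+1%:R / n%:R) * M m.+1 =
  q ^+ m.+1 * ((n%:R - m%:R) / n%:R) * M m by rewrite {1}st; ring.
have {}IH := IH (ltnW mn); rewrite -/(M m) in IH.
rewrite -(mulrA (_ * (_ / _))) IH (binS m.+1) bin1 ffactnSr natrM natrB 1?ltnW //.
rewrite exprD !exprS.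
by field; rewrite expf_neq0.
Qed.

(** At [m = n] only the full count has a nonzero binomial. *)
Lemma nu_full_formula :
  nu n * \prod_(r < n) (1 - q ^+ r.+1 * (1 - r.+1%:R / n%:R))
  = q ^+ (n * n.+1)./2 * (n`!%:R / n%:R ^+ n).
Proof.
have := stationary_moment (leqnn n); rewrite bin2 ffactnn mulnC => <-.
congr (_ * _); rewrite big_ord_recr /= binn mulr1 big1 ?add0r // => k _.
by rewrite bin_small ?mulr0.
Qed.

Let a t := \sum_(k < n.+1) nu k * survive t (repset n k).

(** By invariance [a t] is also the mean of [step (survive t)], which equals [survive t.+1] at every
    state but the full one, where the latter is 0. *)
Lemma stationary_survive_diff t : a t - a t.+1 = nu n * step (survive t) full.
Proof.
rewrite /a -(stationary_step nuS (survive_card_inv t)) -sumrB big_ord_recr /=.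
rewrite repset_full eqxx mulr0 subr0 big1 ?add0r // => k _.
by rewrite repset_neq_full // subrr.
Qed.

(** The first term is the coupling error between non-full starts, the second bounds the stationary
    mass of the full state. *)
Let eps : R := n%:R * q ^+ n *+ 2 + q ^+ n.

Lemma survive_stationary t : `|a t - survive t finset.set0| <= eps.
Proof.
rewrite /a big_ord_recr /= repset_full survive_full mulr0 addr0.
have -> : survive t finset.set0 =
    \sum_(k < n) nu k * survive t finset.set0 + nu n * survive t finset.set0.
  by rewrite -mulr_suml -mulrDl -(big_ord_recr _ nu) /= nu_sum1 mul1r.
rewrite opprD addrA -sumrB; apply: le_trans (ler_normB _ _) _.
apply: lerD; last first.
  rewrite ger0_norm ?mulr_ge0 ?nu_ge0 ?survive_ge0 //.
  by rewrite (le_trans _ nu_full_le) // ler_piMr ?nu_ge0 ?survive_le1.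
apply: le_trans (ler_norm_sum _ _ _) _.
apply: (@le_trans _ _ (\sum_(k < n) nu k * (n%:R * q ^+ n *+ 2))).
  apply: ler_sum => k _; rewrite -mulrBr normrM ger0_norm ?nu_ge0 1?ltnW //.
  by rewrite ler_wpM2l ?nu_ge0 1?ltnW // survive_set0 // repset_neq_full.
rewrite -mulr_suml ler_piMl ?mulrn_wge0 ?mulr_ge0 ?ler0n //.
by rewrite -nu_sum1 big_ord_recr /= lerDl nu_ge0.
Qed.

Lemma step_survive_full t :
  `|step (survive t) full - (1 - q ^+ n) * survive t finset.set0|
    <= (1 - q ^+ n) * (n%:R * q ^+ n *+ 2).
Proof.
have sumE : 1 - q ^+ n = \sum_(S : {set 'I_n} | S != full) Defs.setP p full S.
  by rewrite -[X in X - _](sum_setP full) (bigD1 full) //= setP_full addrAC subrr add0r.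
rewrite /step (bigD1 full) //= survive_full mulr0 add0r sumE !mulr_suml -sumrB.
apply: le_trans (ler_norm_sum _ _ _) _; apply: ler_sum => S Snf.
by rewrite -mulrBr normrM ger0_norm ?setP_ge0 // ler_wpM2l ?setP_ge0 ?survive_set0.
Qed.

Let mu := mu_of n p nu.

Lemma mu_le : mu <= q ^+ n.
Proof.
rewrite /mu mu_ofE (le_trans _ nu_full_le) // ler_piMr ?nu_ge0 //.
by rewrite gerBl.
Qed.

Lemma survive_exponential t :
  `|survive t finset.set0 - (1 - mu) ^+ t| <= eps *+ 3.
Proof.
have eps_ge0 : 0 <= eps by rewrite addr_ge0 // mulrn_wge0 // mulr_ge0 ?ler0n.
have mu_le1 : mu <= 1 by apply: le_trans mu_le _; rewrite exprn_ile1 // ltW.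
(* The error carries a factor [mu]; this is what keeps it from accumulating over about 1/mu
   rounds. *)
have step_a s : `|a s - a s.+1 - mu * a s| <= mu * (eps *+ 2).
  rewrite stationary_survive_diff /mu mu_ofE.
  have := step_survive_full s; have := survive_stationary s.
  set x := step _ _; set y := survive _ _; set z := a s => zy xy.
  have -> : nu n * x - nu n * (1 - q ^+ n) * z =
    nu n * (x - (1 - q ^+ n) * y) - nu n * (1 - q ^+ n) * (z - y) by ring.
  apply: le_trans (ler_normB _ _) _; rewrite !normrM (ger0_norm (nu_ge0 (leqnn n))).
  rewrite mulr2n mulrDr; apply: lerD; last first.
    rewrite ger0_norm; last by rewrite subr_ge0 exprn_ile1 // ltW.
    by rewrite ler_wpM2l // mulr_ge0 ?nu_ge0 // subr_ge0 exprn_ile1 // ltW.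
  rewrite -mulrA ler_wpM2l ?nu_ge0 // (le_trans xy) // ler_wpM2l //.
    by rewrite subr_ge0 exprn_ile1 // ltW.
  by rewrite lerDl.
(* The new error is at most (1 - mu) times the old bound plus [mu] times the same bound, so
   [eps *+ 2] is preserved for all times. *)
have a_exp s : `|a s - (1 - mu) ^+ s| <= eps *+ 2.
  elim: s => [|s IH].
    have := survive_stationary 0; rewrite expr0 /= -card_full cards0 eq_sym -lt0n n_gt0.
    by move=> /le_trans; apply; rewrite mulr2n lerDl.
  have -> : a s.+1 - (1 - mu) ^+ s.+1 =
    (1 - mu) * (a s - (1 - mu) ^+ s) - (a s - a s.+1 - mu * a s).
    by rewrite exprS; ring.
  apply: le_trans (ler_normB _ _) _; rewrite normrM ger0_norm ?subr_ge0 //.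
  apply: le_trans (lerD (ler_wpM2l _ IH) (step_a s)) _; rewrite ?subr_ge0 //.
  by rewrite -mulrDl subrK mul1r.
have -> : survive t finset.set0 - (1 - mu) ^+ t =
  (a t - (1 - mu) ^+ t) - (a t - survive t finset.set0) by ring.
apply: le_trans (ler_normB _ _) _.
by rewrite mulrSr lerD ?survive_stationary.
Qed.

End Stationary.

End CouponChain.

(** * Limits *)

Section RealSequences.
Set Implicit Arguments.
Unset Strict Implicit.
Local Open Scope classical_set_scope.
Variable R : realType.
Implicit Types (q x y z : R).

(** * Elementary sums and q-products *)

Lemma arith_geom_sum q n :
  (1 - q) ^+ 2 * \sum_(r < n) r.+1%:R * q ^+ r = 1 - q ^+ n * (1 + n%:R * (1 - q)).
Proof.
elim: n => [|n IH]; first by rewrite big_ord0; ring.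
by rewrite big_ord_recr /= mulrDr IH (exprS q n) -natr1; ring.
Qed.

Lemma arith_geom_sum_le q n : 0 <= q < 1 ->
  \sum_(r < n) r.+1%:R * q ^+ r <= (1 - q) ^- 2.
Proof.
move=> /andP[q0 q1]; have p0 : 0 < 1 - q by lra.
rewrite -[leRHS]mulr1 mulrC ler_pdivlMr ?exprn_gt0 // mulrC arith_geom_sum.
by rewrite gerBl mulr_ge0 ?exprn_ge0 // addr_ge0 // mulr_ge0 // ltW.
Qed.

Lemma geom_sum_le q n : 0 <= q < 1 -> \sum_(r < n) q ^+ r <= (1 - q)^-1.
Proof.
move=> /andP[q0 q1]; have p0 : 0 < 1 - q by lra.
rewrite -[leRHS]mulr1 mulrC ler_pdivlMr // mulrC -opprB mulNr -subrX1 opprB.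
by rewrite gerBl exprn_ge0.
Qed.

(** The sequence is dominated by the terms of a convergent series, whose partial sums stay below
    [(1 - q) ^- 2]. *)
Lemma cvg_natM_expr q : 0 <= q < 1 -> (fun n => n%:R * q ^+ n) @ \oo --> (0 : R).
Proof.
move=> q01; have /andP[q0 q1] := q01.
pose u n : R := n.+1%:R * q ^+ n.
have u_ge0 n : 0 <= u n by rewrite mulr_ge0 ?exprn_ge0.
have u0 : u @ \oo --> (0 : R).
  apply: cvg_series_cvg_0; apply: nondecreasing_is_cvgn.
    by apply: nondecreasing_series => n _ _.
  exists ((1 - q) ^- 2) => _ [n _ <-].
  by rewrite /series /= big_mkord; exact: arith_geom_sum_le.
apply: (squeeze_cvgr _ (cvg_cst 0) u0); apply: nearW => n.
by rewrite mulr_ge0 ?exprn_ge0 //= ler_wpM2r ?exprn_ge0 // ler_nat.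
Qed.

(** Reciprocal of 1 + z <= exp z at z = y / (1 - y), where 1 + z = 1 / (1 - y). *)
Lemma expR_le_oneB y : 0 <= y < 1 -> expR (- (y / (1 - y))) <= 1 - y.
Proof.
move=> /andP[y0 y1]; have d0 : 0 < 1 - y by lra.
rewrite expRN -[leRHS]invrK lef_pV2 ?posrE ?expR_gt0 ?invr_gt0 //.
apply: le_trans (expR_ge1Dx _); rewrite le_eqVlt; apply/orP; left; apply/eqP.
by field; rewrite lt0r_neq0.
Qed.

(** A bound uniform in [n], so that the infinite product is positive. The previous lemma applies
    with y = q^(r+1), and y / (1 - y) <= q^r / (1 - q) is summed geometrically. *)
Lemma prod_oneB_ge q n : 0 <= q < 1 ->
  expR (- (1 - q) ^- 2) <= \prod_(r < n) (1 - q ^+ r.+1).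
Proof.
move=> q01; have /andP[q0 q1] := q01; have p0 : 0 < 1 - q by lra.
apply: (@le_trans _ _ (\prod_(r < n) expR (- (q ^+ r / (1 - q))))).
  rewrite -expR_sum ler_expR sumrN lerN2 -mulr_suml.
  by rewrite expr2 invfM ler_wpM2r ?invr_ge0 ?geom_sum_le // ltW.
apply: ler_prod => r _; rewrite expR_ge0 /=.
have qr : q ^+ r.+1 <= q by rewrite exprS ler_piMr ?exprn_ile1 // ltW.
have qr0 : 0 <= q ^+ r.+1 by rewrite exprn_ge0.
apply: le_trans (expR_le_oneB _); last by apply/andP; split; lra.
rewrite ler_expR lerN2; apply: ler_pM => //.
- by rewrite invr_ge0; lra.
- by rewrite exprS ler_piMl ?exprn_ge0 // ltW.
- by rewrite lef_pV2 ?posrE; lra.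
Qed.

Lemma cvg_qpoch q : 0 <= q < 1 ->
  (fun n => \prod_(r < n) (1 - q ^+ r.+1)) @ \oo --> qpoch_inf q.
Proof.
move=> q01; have /andP[q0 q1] := q01.
apply: nonincreasing_is_cvgn.
  apply/nonincreasing_seqP => n; rewrite big_ord_recr /= ler_piMr //.
    by rewrite (le_trans (expR_ge0 _) (prod_oneB_ge _ q01)).
  by rewrite gerBl exprn_ge0.
by exists (expR (- (1 - q) ^- 2)) => _ [n _ <-]; exact: prod_oneB_ge.
Qed.

Lemma qpoch_inf_gt0 q : 0 <= q < 1 -> 0 < qpoch_inf q.
Proof.
move=> q01; apply: (lt_le_trans (expR_gt0 (- (1 - q) ^- 2))).
apply: limr_ge; first by apply/cvg_ex; exists (qpoch_inf q); exact: cvg_qpoch.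
by apply: nearW => n; exact: prod_oneB_ge.
Qed.

(** Each factor is at least 1 - q^(r+1) and exceeds it at most by the factor exp((r+1) q^r / ((1-q)
    n)); the total excess is at most exp(C / n). *)
Lemma cvg_stationary_denominator q : 0 < q < 1 ->
  (fun n => \prod_(r < n) (1 - q ^+ r.+1 * (1 - r.+1%:R / n%:R))) @ \oo
    --> qpoch_inf q.
Proof.
move=> /andP[q0 q1]; have q01 : 0 <= q < 1 by rewrite ltW.
have p0 : 0 < 1 - q by lra.
pose C : R := (1 - q) ^- 2 / (1 - q).
pose Q n : R := \prod_(r < n) (1 - q ^+ r.+1).
have Q_ge0 n : 0 <= Q n by rewrite (le_trans (expR_ge0 _) (prod_oneB_ge _ q01)).
have up : (fun n => Q n.+1 * expR (C * n.+1%:R^-1)) @ \oo --> qpoch_inf q.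
  rewrite -[X in _ --> X]mulr1; apply: cvgM.
    by rewrite (cvg_shiftS Q); exact: cvg_qpoch.
  rewrite -[X in _ --> X]expR0; apply: continuous_cvg; first exact: continuous_expR.
  by rewrite -[X in _ --> X](mulr0 C); apply: cvgM; [exact: cvg_cst|exact: cvg_harmonic].
have lo : (fun n => Q n.+1) @ \oo --> qpoch_inf q.
  by rewrite (cvg_shiftS Q); exact: cvg_qpoch.
pose D n : R := \prod_(r < n) (1 - q ^+ r.+1 * (1 - r.+1%:R / n%:R)).
suff : (fun n => D n.+1) @ \oo --> qpoch_inf q by rewrite (cvg_shiftS D).
apply: (squeeze_cvgr _ lo up); apply: nearW => n.
have qr0 r : 0 <= q ^+ r by rewrite exprn_ge0 // ltW.
have qr (r : nat) : q ^+ r.+1 <= q by rewrite exprS ler_piMr ?exprn_ile1 // ltW.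
have N0 : 0 < n.+1%:R :> R by rewrite ltr0n.
apply/andP; split.
  apply: ler_prod => r _; apply/andP; split; first by have := qr r; lra.
  by rewrite lerD2l lerN2 ler_piMr // gerBl divr_ge0.
apply: (@le_trans _ _ (\prod_(r < n.+1) ((1 - q ^+ r.+1) *
    expR (r.+1%:R * q ^+ r / (1 - q) / n.+1%:R)))).
  apply: ler_prod => r _; apply/andP; split.
    rewrite subr_ge0; apply: mulr_ile1 => //.
    - by rewrite subr_ge0 ler_pdivrMr // mul1r ler_nat ltn_ord.
    - by rewrite exprn_ile1 // ltW.
  have := expR_ge1Dx (r.+1%:R * q ^+ r / (1 - q) / n.+1%:R).
  set z := _ / _ / _; set e := expR z => ze.
  have d0 : 0 < 1 - q ^+ r.+1 by have := qr r; lra.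
  apply: (@le_trans _ _ ((1 - q ^+ r.+1) * (1 + z))); last by rewrite ler_wpM2l // ltW.
  (* With y = q^(r+1) and b = (r+1)/(n+1), the goal 1 - y (1 - b) <= (1 - y)(1 + z) amounts to y b
     <= (1 - y) z. *)
  suff : q ^+ r.+1 * (r.+1%:R / n.+1%:R) <= (1 - q ^+ r.+1) * z.
    by set b := _ / _; set y := q ^+ _; nra.
  have -> : (1 - q ^+ r.+1) * z =
      (1 - q ^+ r.+1) / (1 - q) * q ^+ r * (r.+1%:R / n.+1%:R).
    by rewrite /z; field; rewrite !lt0r_neq0.
  rewrite ler_wpM2r ?divr_ge0 //.
  apply: (@le_trans _ _ (q ^+ r)); first by rewrite exprS ler_piMl // ltW.
  by rewrite ler_peMl // ler_pdivlMr // mul1r; have := qr r; lra.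
rewrite big_split /= -expR_sum ler_wpM2l ?Q_ge0 // ler_expR -!mulr_suml.
rewrite ler_wpM2r ?invr_ge0 // ler_wpM2r ?invr_ge0 ?(ltW p0) //.
exact: arith_geom_sum_le.
Qed.

(** * The exponential limit and the scaled distribution function *)

(** The exponent N satisfies N mu <= x < N mu + mu; the two sides use exp(-mu/(1-mu)) <= 1 - mu <=
    exp(-mu). *)
Lemma oneB_expr_bounds x mu : 0 <= x -> 0 < mu < 1 ->
  expR (- (x / (1 - mu))) <= (1 - mu) ^+ Num.truncn (x / mu)
    <= expR (mu - x).
Proof.
move=> x0 /andP[mu0 mu1]; set N := Num.truncn _.
have d0 : 0 < 1 - mu by lra.
have /andP[Nle Ngt] : N%:R <= x / mu < N.+1%:R by rewrite truncn_itv // divr_ge0 // ltW.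
have {}Nle : N%:R * mu <= x by rewrite -ler_pdivlMr.
have {}Ngt : x < N%:R * mu + mu by rewrite -[X in _ + X]mul1r -mulrDl natr1 -ltr_pdivrMr.
apply/andP; split.
  apply: (@le_trans _ _ (expR (- (mu / (1 - mu))) ^+ N)).
    rewrite -expRM_natl ler_expR mulrN lerN2 mulrA ler_wpM2r // invr_ge0 ltW //.
  by rewrite lerXn2r ?nnegrE ?expR_ge0 ?expR_le_oneB ?ltW // mu1.
apply: (@le_trans _ _ (expR (- mu) ^+ N)).
  by rewrite lerXn2r ?nnegrE ?expR_ge0 ?expR_ge1Dx ?ltW.
by rewrite -expRM_natl ler_expR; lra.
Qed.

Lemma cvg_oneB_expr x (mu : nat -> R) : 0 <= x ->
  (\forall n \near \oo, 0 < mu n < 1) -> mu @ \oo --> (0 : R) ->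
  (fun n => (1 - mu n) ^+ Num.truncn (x / mu n)) @ \oo --> expR (- x).
Proof.
move=> x0 mu01 mu0.
have lo : (fun n => expR (- (x / (1 - mu n)))) @ \oo --> expR (- x).
  apply: continuous_cvg; first exact: continuous_expR.
  apply: cvgN; rewrite -[X in _ --> X]divr1; apply: cvgM; first exact: cvg_cst.
  apply: cvgV; first exact: oner_neq0.
  by rewrite -[X in _ --> X]subr0; apply: cvgB => //; exact: cvg_cst.
have up : (fun n => expR (mu n - x)) @ \oo --> expR (- x).
  apply: continuous_cvg; first exact: continuous_expR.
  by rewrite -[X in _ --> X]add0r; apply: cvgB => //; exact: cvg_cst.
apply: (squeeze_cvgr _ lo up).
by apply: filterS mu01 => n; exact: oneB_expr_bounds.
Qed.

Lemma cdf_scaledT_lt0 n p c x : 0 <= c -> x < 0 -> cdf_scaledT n p c x = 0.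
Proof.
move=> c0 x0; rewrite /cdf_scaledT; apply: cvg_lim => //.
apply: cvg_near_cst; apply: nearW => N; rewrite /series /= big1 // => t _.
by rewrite leNgt (lt_le_trans x0) // mulr_ge0.
Qed.

(** The condition c t <= x means that t is at most the integer part of x / c, so the partial sums
    are eventually constant. *)
Lemma cdf_scaledT_sum n p c x : 0 < c -> 0 <= x ->
  cdf_scaledT n p c x = \sum_(t < (Num.truncn (x / c)).+1) probT n p t.
Proof.
move=> c0 x0; rewrite /cdf_scaledT; apply: cvg_lim => //.
set M := Num.truncn _.
apply: cvg_near_cst; exists M.+1 => // N /= MN.
rewrite /series /= big_mkord -big_mkcond.
rewrite (big_ord_widen_cond _ xpredT _ MN) /=; apply: eq_bigl => t.
by rewrite ltnS -ler_pdivlMl // mulrC truncn_ge_nat // divr_ge0 // ltW.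
Qed.

End RealSequences.

(** * Assembly of the limit law and of the asymptotics of the rate *)

Local Open Scope classical_set_scope.

Lemma stationary_denominator_gt0 (R : realType) (q : R) (n : nat) : 0 < q < 1 ->
  0 < \prod_(r < n) (1 - q ^+ r.+1 * (1 - r.+1%:R / n%:R)).
Proof.
move=> /andP[q0 q1]; apply: prodr_gt0 => r _.
have n0 : 0 < n%:R :> R by rewrite ltr0n (leq_ltn_trans _ (ltn_ord r)).
rewrite subr_gt0; apply: (@le_lt_trans _ _ (q ^+ r.+1)).
  by rewrite ler_piMr ?exprn_ge0 ?(ltW q0) // gerBl divr_ge0.
by rewrite exprn_ilt1 // ltW.
Qed.

Theorem mainTheorem5 (R : realType) (p : R) (nu : nat -> nat -> R) :
  0 < p < 1 ->
  (forall n : nat, (0 < n)%N -> count_stationary n p (nu n)) ->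
  (forall x : R,
     (fun n : nat => cdf_scaledT n p (mu_of n p (nu n)) x) @ \oo
       --> exp1_cdf x) /\
  ((fun n : nat =>
      mu_of n p (nu n) /
        ((qpoch_inf (1 - p))^-1 * (n`!%:R / n%:R ^+ n)
         * (1 - p) ^+ (n * n.+1)./2)) @ \oo --> (1 : R)).
Proof.
move=> p01 nuS; have /andP[p0 p1] := p01.
set q := 1 - p; have q0 : 0 < q by rewrite /q; lra.
have q1 : q < 1 by rewrite /q; lra.
have q01 : 0 < q < 1 by rewrite q0.
have q01' : 0 <= q < 1 by rewrite ltW.
pose mu n := mu_of n p (nu n).
pose D n : R := \prod_(r < n) (1 - q ^+ r.+1 * (1 - r.+1%:R / n%:R)).
have qn_cvg0 : (fun n => q ^+ n) @ \oo --> (0 : R).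
  by apply: cvg_expr; rewrite ger0_norm // ltW.
have muE n : (0 < n)%N ->
    mu n = q ^+ (n * n.+1)./2 * (n`!%:R / n%:R ^+ n) / D n * (1 - q ^+ n).
  move=> n0; rewrite /mu (mu_ofE n0 (nuS n n0)).
  rewrite -(nu_full_formula n0 (nuS n n0)) -/q -/(D n) mulfK //.
  by rewrite lt0r_neq0 // stationary_denominator_gt0.
have mu_gt0 n : (0 < n)%N -> 0 < mu n.
  move=> n0; rewrite muE // !mulr_gt0 ?invr_gt0 ?exprn_gt0 ?ltr0n ?fact_gt0 //.
    exact: stationary_denominator_gt0.
  by rewrite subr_gt0 exprn_ilt1 ?ltW // -lt0n.
have mu_le n : (0 < n)%N -> mu n <= q ^+ n by move=> n0; exact: mu_le (nuS n n0).
have near_gt0 : \forall n \near \oo, (0 < n)%N by exists 1%N.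
have mu_cvg0 : mu @ \oo --> (0 : R).
  apply: (squeeze_cvgr _ (cvg_cst 0) qn_cvg0).
  by apply: filterS near_gt0 => n n0; rewrite ltW ?mu_gt0 ?mu_le.
split.
- move=> x; rewrite /exp1_cdf; have [x0|x0] := ltP x 0.
    apply: cvg_near_cst; apply: filterS near_gt0 => n n0.
    by rewrite cdf_scaledT_lt0 // ltW // mu_gt0.
  have mu01 : \forall n \near \oo, 0 < mu n < 1.
    apply: filterS near_gt0 => n n0; rewrite mu_gt0 //=.
    by apply: le_lt_trans (mu_le n n0) _; rewrite exprn_ilt1 ?ltW // -lt0n.
  (* The uniform error [eps *+ 3] of [survive_exponential], now as a sequence in [n]. *)
  pose e n : R := (n%:R * q ^+ n *+ 2 + q ^+ n) *+ 3.
  have e0 : e @ \oo --> (0 : R).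
    rewrite -[X in _ --> X](mul0rn _ 3) -[X in _ --> X *+ _]addr0.
    rewrite -[X in _ --> (X + _) *+ _](mul0rn _ 2).
    apply: cvgMn; apply: cvgD => //; apply: cvgMn; exact: cvg_natM_expr.
  pose g n : R := (1 - mu n) ^+ Num.truncn (x / mu n).
  have gx : g @ \oo --> expR (- x) by exact: cvg_oneB_expr.
  have lo : (fun n => 1 - g n - e n) @ \oo --> 1 - expR (- x).
    rewrite -[X in _ --> X]subr0; apply: cvgB => //.
    by apply: cvgB => //; exact: cvg_cst.
  have up : (fun n => 1 - g n + e n) @ \oo --> 1 - expR (- x).
    rewrite -[X in _ --> X]addr0; apply: cvgD => //.
    by apply: cvgB => //; exact: cvg_cst.
  apply: (squeeze_cvgr _ lo up); apply: filterS near_gt0 => n n0.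
  rewrite cdf_scaledT_sum ?mu_gt0 // (sum_probT p n0).
  have := survive_exponential n0 p01 (nuS n n0) (Num.truncn (x / mu n)).
  by rewrite ler_norml -/q -/(mu n) -/(g n) -/(e n) => /andP[? ?]; apply/andP; split; lra.
- have Qinf0 : qpoch_inf q != 0 by rewrite lt0r_neq0 // qpoch_inf_gt0.
  (* This is the ratio in the goal once the factorial and the powers of [n] and [q] cancel. *)
  have h : (fun n => (1 - q ^+ n) * (qpoch_inf q / D n)) @ \oo --> (1 : R).
    rewrite -[X in _ --> X]mulr1; apply: cvgM.
      by rewrite -[X in _ --> X]subr0; apply: cvgB => //; exact: cvg_cst.
    rewrite -[X in _ --> X](divff Qinf0); apply: cvgM; first exact: cvg_cst.
    by apply: cvgV => //; exact: cvg_stationary_denominator.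
  apply: cvg_trans h; apply: near_eq_cvg; apply: filterS near_gt0 => n n0.
  rewrite -/(mu n) muE //; field.
  rewrite Qinf0 !expf_neq0 ?lt0r_neq0 ?ltr0n ?fact_gt0 //.
  exact: stationary_denominator_gt0.
Qed.
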